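(* Let $\mathcal{N}$ be a matching class in a category $\mathbf{X}$ with pullbacks. Let $m:M\to X$ be an $\mathcal{N}$-adhesive monomorphism and let $n:N\to X$ be a monomorphism in $\mathcal{N}$. Let $p_1:P\to M$, $p_2:P\to N$ form a pullback of $m$ and $n$ (so $m\circ p_1=n\circ p_2$), let $u_1:N\to U$, $u_2:M\to U$ form a pushout of $p_2$ and $p_1$ (so $u_1\circ p_2=u_2\circ p_1$), and let $u:U\to X$ be the unique arrow with $u\circ u_1=n$ and $u\circ u_2=m$. Then $u$ is a monomorphism and, in the poset $(\mathsf{Sub}(X),\le)$, $[u]=[m]\vee[n]$.
   Context: A class $\mathcal{A}$ of arrows is stable under pullbacks (resp. pushouts) if for every pullback (resp. pushout) square with $f:A\to B$, $m:A\to C$, $n:B\to D$, $g:C\to D$, $n\circ f=g\circ m$, $n\in\mathcal{A}$ implies $m\in\mathcal{A}$ (resp. $m\in\mathcal{A}$ implies $n\in\mathcal{A}$). A matching class $\mathcal{N}$ is a class of arrows of $\mathbf{X}$ that contains all isomorphisms, is closed under composition, is closed under decomposition ($g\circ f\in\mathcal{N}$ and $g\in\mathcal{N}$ imply $f\in\mathcal{N}$), and is stable under pullbacks and pushouts. A pushout square $g:A\to B$, $m:A\to C$, $n:B\to D$, $f:C\to D$ is stable if for every commutative cube having it as bottom face, with vertical arrows $a:A'\to A$, $b:B'\to B$, $c:C'\to C$, $d:D'\to D$, if all four vertical faces are pullbacks then the top face is a pushout. An arrow $m:X\to Y$ is $\mathcal{N}$-preadhesive if for every $n:X\to Z$ in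 $\mathcal{N}$ a stable pushout square of $m$ along $n$ exists and it is also a pullback square. It is $\mathcal{N}$-adhesive if all its pullbacks are $\mathcal{N}$-preadhesive. (Hence, in the claim, the pushout of $p_2$ and $p_1$ exists, since $p_2$ is a pullback of $m$ and $p_1\in\mathcal{N}$ is a pullback of $n$.) $(\mathsf{Sub}(X),\le)$ is the poset of subobjects of $X$: isomorphism classes $[m]$ of monos into $X$, with $[m]\le[n]$ iff $m$ factors through $n$. *)

(* Defs.v *)
From Stdlib Require Import Relations FunctionalExtensionality
  PropExtensionality ProofIrrelevance.

Set Implicit Arguments.
Unset Strict Implicit.

Record category := Category {
  ob :> Type;
  hom : ob -> ob -> Type;
  idc : forall A, hom A A;
  comp : forall A B C, hom B C -> hom A B -> hom A C;
  compA : forall A B C D (h : hom C D) (g : hom B C) (f : hom A B),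
    comp h (comp g f) = comp (comp h g) f;
  comp1f : forall A B (f : hom A B), comp (idc B) f = f;
  compf1 : forall A B (f : hom A B), comp f (idc A) = f }.

Arguments idc {c} A.

Declare Scope cat_scope.
Delimit Scope cat_scope with cat.
Notation "g ∘ f" := (comp g f) (at level 40, left associativity) : cat_scope.
Local Open Scope cat_scope.

Definition arrow_class (X : category) := forall A B : X, hom A B -> Prop.

Section Arrows.
Variable X : category.

Definition iso (A B : X) (f : hom A B) : Prop :=
  exists g : hom B A, g ∘ f = idc A /\ f ∘ g = idc B.

Definition monic (A B : X) (f : hom A B) : Prop :=
  forall (Q : X) (h k : hom Q A), f ∘ h = f ∘ k -> h = k.

(* Throughout, a square is given as  f : A -> B,  m : A -> C,  n : B -> D,
   g : C -> D,  in this order, with  n ∘ f = g ∘ m;  f is opposite to g and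
   m is opposite to n. *)
Definition pullback (A B C D : X)
    (f : hom A B) (m : hom A C) (n : hom B D) (g : hom C D) : Prop :=
  n ∘ f = g ∘ m /\
  forall (Q : X) (b : hom Q B) (c : hom Q C), n ∘ b = g ∘ c ->
    exists! h : hom Q A, f ∘ h = b /\ m ∘ h = c.

Definition pushout (A B C D : X)
    (f : hom A B) (m : hom A C) (n : hom B D) (g : hom C D) : Prop :=
  n ∘ f = g ∘ m /\
  forall (Q : X) (b : hom B Q) (c : hom C Q), b ∘ f = c ∘ m ->
    exists! h : hom D Q, h ∘ n = b /\ h ∘ g = c.

Definition has_pullbacks : Prop :=
  forall (B C D : X) (n : hom B D) (g : hom C D),
  exists (A : X) (f : hom A B) (m : hom A C), pullback f m n g.

Definition stable_under_pullbacks (N : arrow_class X) : Prop :=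
  forall (A B C D : X)
    (f : hom A B) (m : hom A C) (n : hom B D) (g : hom C D),
  pullback f m n g -> N B D n -> N A C m.

Definition stable_under_pushouts (N : arrow_class X) : Prop :=
  forall (A B C D : X)
    (f : hom A B) (m : hom A C) (n : hom B D) (g : hom C D),
  pushout f m n g -> N A C m -> N B D n.

Record matching_class (N : arrow_class X) : Prop := MatchingClass {
  matching_iso : forall (A B : X) (f : hom A B), iso f -> N A B f;
  matching_comp : forall (A B C : X) (g : hom B C) (f : hom A B),
    N B C g -> N A B f -> N A C (g ∘ f);
  matching_decomp : forall (A B C : X) (g : hom B C) (f : hom A B),
    N A C (g ∘ f) -> N B C g -> N A B f;
  matching_pullback : stable_under_pullbacks N;
  matching_pushout : stable_under_pushouts N }.

(* The primed square is the top face of the cube.  Commutativity of the vertical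
   faces is part of their being pullbacks; that of the top face does not follow
   from the rest, hence the explicit hypothesis. *)
Definition stable_pushout (A B C D : X)
    (g : hom A B) (m : hom A C) (n : hom B D) (f : hom C D) : Prop :=
  pushout g m n f /\
  forall (A' B' C' D' : X)
    (g' : hom A' B') (m' : hom A' C') (n' : hom B' D') (f' : hom C' D')
    (a : hom A' A) (b : hom B' B) (c : hom C' C) (d : hom D' D),
  n' ∘ g' = f' ∘ m' ->
  pullback g' a b g -> pullback m' a c m ->
  pullback n' b d n -> pullback f' c d f ->
  pushout g' m' n' f'.

Definition preadhesive (N : arrow_class X) (A B : X) (m : hom A B) : Prop :=
  forall (C : X) (n : hom A C), N A C n ->
  exists (D : X) (p : hom B D) (q : hom C D),
    stable_pushout m n p q /\ pullback m n p q.

Definition adhesive (N : arrow_class X) (B D : X) (n : hom B D) : Prop :=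
  forall (A C : X) (f : hom A B) (m : hom A C) (g : hom C D),
  pullback f m n g -> preadhesive N m.

End Arrows.

Section Subobjects.
Variables (X : category) (Y : X).

Record mono_into := MonoInto {
  mono_dom : X;
  mono_arr : hom mono_dom Y;
  mono_arrP : monic mono_arr }.

Definition factors_through (m n : mono_into) : Prop :=
  exists h : hom (mono_dom m) (mono_dom n), mono_arr n ∘ h = mono_arr m.

Definition iso_over (m n : mono_into) : Prop :=
  exists h : hom (mono_dom m) (mono_dom n),
    iso h /\ mono_arr n ∘ h = mono_arr m.

Definition Sub : Type :=
  {S : mono_into -> Prop | exists m, S = iso_over m}.

Definition sub_class (m : mono_into) : Sub :=
  exist _ (iso_over m) (ex_intro _ m eq_refl).

Definition sub_le (S T : Sub) : Prop :=
  exists m n, S = sub_class m /\ T = sub_class n /\ factors_through m n.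

Lemma factors_trans m n p :
  factors_through m n -> factors_through n p -> factors_through m p.
Proof.
intros [h Hh] [k Hk]; exists (k ∘ h); now rewrite compA, Hk.
Qed.

Lemma iso_overP m n :
  iso_over m n <-> factors_through m n /\ factors_through n m.
Proof.
split.
- intros [h [[k [Hkh Hhk]] E]]; split; [now exists h|].
  exists k; now rewrite <- E, <- compA, Hhk, compf1.
- intros [[h Hh] [k Hk]]; exists h; split; [|easy].
  exists k; split; apply mono_arrP; rewrite compA, compf1.
  + now rewrite Hk.
  + now rewrite Hh.
Qed.

Lemma sub_classP (S : Sub) : exists m, S = sub_class m.
Proof.
destruct S as [S [m E]]; exists m; subst S; reflexivity.
Qed.

Lemma sub_class_eq m n :
  sub_class m = sub_class n <-> iso_over m n.
Proof.
split.
- intros E; apply (f_equal (@proj1_sig _ _)) in E; simpl in E.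
  rewrite E; apply iso_overP; split; exists (idc _); apply compf1.
- intros H; assert (E : iso_over m = iso_over n).
  { apply functional_extensionality; intros p; apply propositional_extensionality.
    rewrite !iso_overP; apply iso_overP in H; destruct H as [H1 H2].
    split; intros [K1 K2]; split; eauto using factors_trans. }
  unfold sub_class; now apply subset_eq_compat.
Qed.

Lemma sub_le_class m n :
  sub_le (sub_class m) (sub_class n) <-> factors_through m n.
Proof.
split.
- intros [m' [n' [Em [En H]]]].
  apply sub_class_eq, iso_overP in Em; apply sub_class_eq, iso_overP in En.
  apply (factors_trans (proj1 Em)), (factors_trans H), (proj2 En).
- intros H; now exists m, n.
Qed.

Lemma sub_le_order : order Sub sub_le.
Proof.
split.
- intros S; destruct (sub_classP S) as [m ->]; apply sub_le_class.
  exists (idc _); apply compf1.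
- intros S T U; destruct (sub_classP S) as [m ->], (sub_classP T) as [n ->],
    (sub_classP U) as [p ->]; rewrite !sub_le_class; apply factors_trans.
- intros S T; destruct (sub_classP S) as [m ->], (sub_classP T) as [n ->].
  rewrite !sub_le_class, sub_class_eq, iso_overP; auto.
Qed.

End Subobjects.

Definition is_join (T : Type) (le : relation T) (a b c : T) : Prop :=
  le a c /\ le b c /\ forall d, le a d -> le b d -> le c d.

(* Main.v *)
(* Stability of the pushout makes N and M cover every generalized element of U,
   so equality of two arrows into U may be tested where both arguments come from
   N or M.  For h, k with u ∘ h = u ∘ k, if both come from N (or both from M)
   they agree because n (or m) is monic; if one comes from N and the other from M
   they come from a common element of the pullback P, on which u1 and u2 agree. *)
Require Import Defs.
Local Open Scope cat_scope.

Section Squares.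
Set Implicit Arguments.
Unset Strict Implicit.
Variable X : category.

Lemma pullback_sym (A B C D : X)
    (f : hom A B) (m : hom A C) (n : hom B D) (g : hom C D) :
  pullback f m n g -> pullback m f g n.
Proof.
intros [E H]; split; [now symmetry|].
intros Q b c Ebc; destruct (H Q c b (eq_sym Ebc)) as [h [[H1 H2] Hu]].
exists h; split; [easy|]; intros h' [H1' H2']; now apply Hu.
Qed.

Lemma pullback_jointly_monic (A B C D : X)
    (f : hom A B) (m : hom A C) (n : hom B D) (g : hom C D) :
  pullback f m n g -> forall (Q : X) (h k : hom Q A),
  f ∘ h = f ∘ k -> m ∘ h = m ∘ k -> h = k.
Proof.
intros [E H] Q h k Ef Em.
destruct (H Q (f ∘ k) (m ∘ k)) as [w [_ Hw]]; [now rewrite !compA, E|].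
transitivity w; [symmetry|]; now apply Hw.
Qed.

Lemma pushout_jointly_epic (A B C D : X)
    (f : hom A B) (m : hom A C) (n : hom B D) (g : hom C D) :
  pushout f m n g -> forall (Q : X) (h k : hom D Q),
  h ∘ n = k ∘ n -> h ∘ g = k ∘ g -> h = k.
Proof.
intros [E H] Q h k En Eg.
destruct (H Q (k ∘ n) (k ∘ g)) as [w [_ Hw]]; [now rewrite <- !compA, E|].
transitivity w; [symmetry|]; now apply Hw.
Qed.

Lemma pullback_postcomp_monic (A B C D E : X)
    (f : hom A B) (m : hom A C) (n : hom B D) (g : hom C D) (e : hom D E) :
  monic e -> pullback f m n g -> pullback f m (e ∘ n) (e ∘ g).
Proof.
intros He [Sq H]; split; [now rewrite <- !compA, Sq|].
intros Q b c Ebc; apply H, He; now rewrite !compA.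
Qed.

(** Preadhesivity only provides some stable pushout of a span; this carries stability over to any
    given pushout of it. A cube over the second square becomes one over the first when its map [d]
    is composed with the comparison [e]. *)
Lemma pushout_stable (A B C D D1 : X) (g : hom A B) (m : hom A C)
    (n : hom B D) (f : hom C D) (n1 : hom B D1) (f1 : hom C D1) :
  stable_pushout g m n f -> pushout g m n1 f1 -> stable_pushout g m n1 f1.
Proof.
intros [PO St] PO1; split; [exact PO1|].
destruct (proj2 PO1 D n f (proj1 PO)) as [e [[En Ef] _]].
destruct (proj2 PO D1 n1 f1 (proj1 PO1)) as [r [[Rn Rf] _]].
(* [e] is split monic, so composing with it keeps the faces over [n1] and [f1] pullbacks. *)
assert (Ere : r ∘ e = idc D1).
{ apply (pushout_jointly_epic PO1); now rewrite <- compA, ?En, ?Ef, comp1f. }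
assert (He : monic e).
{ intros Q h k E.
  rewrite <- (comp1f h), <- (comp1f k), <- Ere, <- !compA; now rewrite E. }
intros A' B' C' D' g' m' n' f' a b c d Top Fg Fm Fn Ff.
apply (St A' B' C' D' g' m' n' f' a b c (e ∘ d) Top Fg Fm).
- rewrite <- En; now apply pullback_postcomp_monic.
- rewrite <- Ef; now apply pullback_postcomp_monic.
Qed.

(** Pulling the whole square back along [d] gives, by stability, a pushout with apex [Q]. Its two
    legs are jointly epic, and the hypotheses say that [h] and [k] agree on each of them. *)
Lemma stable_pushout_cover (hX : has_pullbacks X) (A B C D : X)
    (g : hom A B) (m : hom A C) (n : hom B D) (f : hom C D) :
  stable_pushout g m n f ->
  forall (Q Z : X) (d : hom Q D) (h k : hom Q Z),
  (forall (T : X) (t : hom T Q) (x : hom T B), d ∘ t = n ∘ x -> h ∘ t = k ∘ t) ->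
  (forall (T : X) (t : hom T Q) (y : hom T C), d ∘ t = f ∘ y -> h ∘ t = k ∘ t) ->
  h = k.
Proof.
intros [[Sq _] St] Q Z d h k HB HC.
destruct (hX _ _ _ d n) as [B' [n' [b Fn]]].
destruct (hX _ _ _ d f) as [C' [f' [c Ff]]].
destruct (hX _ _ _ b g) as [A' [g' [a Fg]]].
pose proof (proj1 Fn) as En; pose proof (proj1 Ff) as Ef.
pose proof (proj1 Fg) as Eg.
destruct (proj2 Ff A' (n' ∘ g') (m ∘ a)) as [m' [[Top Em] _]].
{ rewrite !compA, En, <- Sq, <- !compA; now rewrite Eg. }
(* Pullback cancellation: pasted with the face over [f], this face has the same outer rectangle as
   the pasted faces over [g] and [n], which is a pullback. *)
assert (Fm : pullback m' a c m).
{ split; [easy|]; intros T x y Exy.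
  destruct (proj2 Fn T (f' ∘ x) (g ∘ y)) as [z [[Z1 Z2] _]].
  { rewrite !compA, Ef, Sq, <- !compA; now rewrite Exy. }
  destruct (proj2 Fg T z y Z2) as [w [[W1 W2] _]].
  exists w; split; [split; [|easy]|].
  - apply (pullback_jointly_monic Ff).
    + now rewrite compA, Top, <- compA, W1.
    + now rewrite compA, Em, <- compA, W2.
  - intros w' [V1 V2]; apply (pullback_jointly_monic Fg).
    + rewrite W1; apply (pullback_jointly_monic Fn).
      * now rewrite Z1, <- V1, !compA, Top.
      * now rewrite Z2, <- V2, !compA, Eg.
    + now rewrite W2, V2. }
assert (PO : pushout g' m' n' f') by (eapply St; eauto).
apply (pushout_jointly_epic PO); eauto.
Qed.

Lemma pushout_of_pullback_monic (hX : has_pullbacks X) (M N Y P U : X)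
    (m : hom M Y) (n : hom N Y) (p1 : hom P M) (p2 : hom P N)
    (u1 : hom N U) (u2 : hom M U) (u : hom U Y) :
  monic m -> monic n -> pullback p1 p2 m n -> stable_pushout p2 p1 u1 u2 ->
  u ∘ u1 = n -> u ∘ u2 = m -> monic u.
Proof.
intros Hm Hn PB St E1 E2 Q h k Ehk.
assert (Mixed : forall (T : X) (x : hom T N) (y : hom T M),
  n ∘ x = m ∘ y -> u1 ∘ x = u2 ∘ y).
{ intros T x y E; destruct (proj2 PB T y x (eq_sym E)) as [p [[<- <-] _]].
  now rewrite !compA, (proj1 (proj1 St)). }
(* Covering along [h], then along the restriction [k ∘ t], leaves four cases, in the order NN, NM,
   MN, MM. *)
apply (stable_pushout_cover hX St (d := h)); intros T t x Ex;
  apply (stable_pushout_cover hX St (d := k ∘ t)); intros T' t' x' Ex';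
  rewrite Ex', Ex, <- compA;
  assert (E : u ∘ (h ∘ t ∘ t') = u ∘ (k ∘ t ∘ t')) by now rewrite !compA, Ehk.
all: rewrite Ex', Ex, !compA, ?E1, ?E2, <- compA in E.
- now rewrite (Hn _ _ _ E).
- now apply Mixed.
- symmetry; now apply Mixed.
- now rewrite (Hm _ _ _ E).
Qed.

End Squares.

Theorem proposition3p9 (X : category) (hX : has_pullbacks X)
  (calN : arrow_class X) (hcalN : matching_class calN)
  (M N Y : X) (m : hom M Y) (n : hom N Y)
  (m_adh : adhesive calN m) (m_mono : monic m)
  (n_mono : monic n) (n_in : calN N Y n)
  (P : X) (p1 : hom P M) (p2 : hom P N) (hP : pullback p1 p2 m n)
  (U : X) (u1 : hom N U) (u2 : hom M U) (hU : pushout p2 p1 u1 u2)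
  (u : hom U Y) (hu1 : u ∘ u1 = n) (hu2 : u ∘ u2 = m) :
  exists u_mono : monic u,
    is_join (@sub_le X Y)
      (sub_class (MonoInto m_mono)) (sub_class (MonoInto n_mono))
      (sub_class (MonoInto u_mono)).
Proof.
assert (p1_in : calN P M p1)
  by apply (matching_pullback hcalN (pullback_sym hP) n_in).
(* [p2] is a pullback of [m], hence preadhesive, and is pushed out along [p1]. *)
destruct (m_adh _ _ _ _ _ hP _ p1 p1_in) as [D [q1 [q2 [St _]]]].
exists (pushout_of_pullback_monic hX m_mono n_mono hP
  (pushout_stable St hU) hu1 hu2).
split; [|split].
- apply sub_le_class; now exists u2.
- apply sub_le_class; now exists u1.
- intros S; destruct (sub_classP S) as [e ->]; rewrite !sub_le_class.
  intros [h Hh] [k Hk]; simpl in h, k, Hh, Hk.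
  (* The factorizations of [n] and [m] through an upper bound [e] agree on [P] because [e] is monic,
     so they glue to a map out of [U]. *)
  destruct (proj2 hU _ k h) as [r [[R1 R2] _]].
  { apply (mono_arrP (m := e)).
    now rewrite !compA, Hh, Hk, (proj1 hP). }
  exists r; simpl; apply (pushout_jointly_epic hU).
  + now rewrite <- compA, R1, hu1.
  + now rewrite <- compA, R2, hu2.
Qed.
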